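(* Let $\mathcal B$ be a semitopological barycentric algebra, let $p\colon\mathcal B\to\overline{\mathbb R}_+$ be convex, let $q\colon\mathcal B\to\overline{\mathbb R}_+$ be concave and lower semicontinuous, and assume that $q\le p$ (pointwise). Then there is an affine lower semicontinuous map $\Lambda\colon\mathcal B\to\overline{\mathbb R}_+$ such that $q\le\Lambda\le p$. If $\mathcal B$ is pointed and $p$ is strict (e.g., sublinear), then $\Lambda$ is linear.
   Context: $\overline{\mathbb R}_+=[0,\infty]$ (with $0\cdot\infty=0$) carries the Scott topology (open sets $]a,\infty]$ with $a\in[0,\infty[$, the whole set, $\emptyset$); lower semicontinuous means continuous into it. A barycentric algebra is a set $\mathcal B$ with operations $+_a$, $a\in[0,1]$, such that $x+_1y=x$, $x+_ax=x$, $x+_ay=y+_{1-a}x$, and $(x+_ay)+_bz=x+_{ab}(y+_{\frac{(1-a)b}{1-ab}}z)$ if $a<1$, $b<1$. It is semitopological if it has a topology making $(x,a,y)\mapsto x+_ay$ separately continuous on $\mathcal B\times[0,1]\times\mathcal B$, with $[0,1]$ having its metric topology. It is pointed if it has a distinguished element $\bot$ that is least in the specialization preordering ($x\le y$ iff every open neighborhood of $x$ contains $y$); then $a\cdot x:=x+_a\bot$. A map $f\colon\mathcal B\to\overline{\mathbb R}_+$ is affine (resp. concave, convex) if $f(x+_ay)=af(x)+(1-a)f(y)$ (resp. $\ge$, $\le$) for all $x,y\in\mathcal B$, $a\in[0,1]$. In the pointed case, $f$ is strict if $f(\bot)=0$, $\mathbb I$-homogeneous if $f(a\cdot x)=af(x)$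 for all $a\in[0,1]$, linear (resp. sublinear) if $\mathbb I$-homogeneous and affine (resp. convex). *)

(* Defs.v *)
From HB Require Import structures.
From mathcomp Require Import all_boot all_order all_algebra.
From mathcomp Require Import interval_inference.
From mathcomp Require Import boolp classical_sets reals ereal topology normedtype.
From mathcomp Require Import convex.

Set Implicit Arguments.
Unset Strict Implicit.
Unset Printing Implicit Defensive.

Import Order.TTheory GRing.Theory Num.Theory.
Import numFieldNormedType.Exports.

Local Open Scope classical_set_scope.
Local Open Scope ring_scope.
Local Open Scope convex_scope.

(* Barycentric algebras are the [convType R] of the library: [x <| a |> y] is
   x +_a y, the weight a being that of x.  The library's law
   [convex_quasi_associative] is a division-free form of the usual one; the two
   lemmas below show that they are interchangeable. *)

Section BarycentricAxioms.
Context {R : realType}.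

Lemma baryA (B : convType R) (a b c : {i01 R}) (x y z : B) :
  (a%:num < 1)%R -> (b%:num < 1)%R ->
  c%:num = ((1 - a%:num) * b%:num / (1 - a%:num * b%:num))%R ->
  (x <| a |> y) <| b |> z = x <| (a%:num * b%:num)%:i01 |> (y <| c |> z).
Proof.
move=> a1 b1 cE; apply/esym/convA => //=; rewrite cE /unstable.onem.
have ab1 : (1 - a%:num * b%:num != 0)%R.
  rewrite subr_eq0 eq_sym lt_eqF//.
  by rewrite (le_lt_trans _ b1)// ler_piMl// ltW.
rewrite mulrBr mulr1 mulrCA divff// mulr1 mulrBl mul1r opprB addrA.
by rewrite subrK.
Qed.

Lemma bary_quasi_associative (T : Type) (cv : {i01 R} -> T -> T -> T) :
  (forall x y, cv 1%:i01 x y = x) ->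
  (forall a x, cv a x x = x) ->
  (forall (a : {i01 R}) x y, cv a x y = cv (1 - a%:num)%:i01 y x) ->
  (forall (a b c : {i01 R}) x y z, (a%:num < 1)%R -> (b%:num < 1)%R ->
    c%:num = ((1 - a%:num) * b%:num / (1 - a%:num * b%:num))%R ->
    cv b (cv a x y) z = cv (a%:num * b%:num)%:i01 x (cv c y z)) ->
  convex_quasi_associative cv.
Proof.
move=> cv1 cvI cvC cvA p q r s x y z prs spq.
have cv0 u v : cv 0%:i01 u v = v.
  rewrite cvC [X in cv X](_ : _ = 1%:i01) ?cv1//.
  by apply/val_inj => /=; rewrite subr0.
have i01E (t u : {i01 R}) : t%:num = u%:num -> t = u by move=> tu; exact/val_inj.
have [s1|s1] := eqVneq s%:num 1%R.
  rewrite (i01E s 1%:i01)// cv1.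
  have -> : r = p by apply: i01E; rewrite prs s1 mulr1.
  move: spq; rewrite s1 /unstable.onem subrr => /esym/eqP; rewrite mulf_eq0 !subr_eq0.
  move=> /orP[/eqP p1|/eqP q1].
    by rewrite (i01E p 1%:i01)// !cv1.
  by rewrite (i01E q 1%:i01)// cv1.
have [r1|r1] := eqVneq r%:num 1%R.
  rewrite (i01E r 1%:i01)// cv1.
  have ps : p = s by apply: i01E; rewrite prs r1 mul1r.
  rewrite ps; congr (cv _ _ _).
  suff q0 : q%:num = 0 by rewrite (i01E q 0%:i01)// cv0.
  have s0 : 1 - s%:num != 0 by rewrite subr_eq0 eq_sym.
  move: spq; rewrite ps /unstable.onem -[LHS]mulr1 => /(mulfI s0)/eqP.
  by rewrite -subr_eq0 opprB addrC subrK => /eqP.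
have {}r1 : (r%:num < 1)%R by rewrite lt_neqAle r1 le1.
have {}s1 : (s%:num < 1)%R by rewrite lt_neqAle s1 le1.
have rs1 : (1 - r%:num * s%:num)%R \is a GRing.unit.
  rewrite unitfE subr_eq0 eq_sym lt_eqF//.
  by rewrite (le_lt_trans _ s1)// ler_piMl// ltW.
rewrite (cvA r s q)//; first by congr (cv _ _ _); exact: i01E.
have := ConvexQuasiAssoc.qE _ prs spq.
by rewrite prs mulrC => ->//; rewrite [(s%:num * _)%R]mulrC.
Qed.

End BarycentricAxioms.

(* Continuity of x +_a y in each of its three arguments separately; [0,1]
   carries the topology induced by that of R. *)
HB.mixin Record isSemitopologicalBary (R : realType) T
    of ConvexSpace R T & Topological T := {
  conv_continuousl : forall (a : {i01 R}) (y : T),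
    continuous (fun x : T => x <| a |> y) ;
  conv_continuousr : forall (a : {i01 R}) (x : T),
    continuous (fun y : T => x <| a |> y) ;
  conv_continuousw : forall x y : T,
    continuous (fun a : initial_topology (fun t : {i01 R} => t%:num : R) =>
      x <| a |> y)
}.

#[short(type=semitopBaryType)]
HB.structure Definition SemitopologicalBary (R : realType) :=
  {T of ConvexSpace R T & Topological T & isSemitopologicalBary R T}.

Local Open Scope ereal_scope.

Section Maps.
Context {R : realType} {B : convType R}.
Implicit Type f : B -> \bar R.

Definition bary_affine f := forall (a : {i01 R}) (x y : B),
  f (x <| a |> y) = a%:num%:E * f x + (1 - a%:num)%R%:E * f y.

Definition bary_concave f := forall (a : {i01 R}) (x y : B),
  a%:num%:E * f x + (1 - a%:num)%R%:E * f y <= f (x <| a |> y).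

Definition bary_convex f := forall (a : {i01 R}) (x y : B),
  f (x <| a |> y) <= a%:num%:E * f x + (1 - a%:num)%R%:E * f y.

Variable bot : B.

Definition scal_bot (a : {i01 R}) (x : B) : B := x <| a |> bot.

Definition bary_strict f := f bot = 0.

Definition I_homogeneous f := forall (a : {i01 R}) (x : B),
  f (scal_bot a x) = a%:num%:E * f x.

Definition bary_linear f := I_homogeneous f /\ bary_affine f.

Definition bary_sublinear f := I_homogeneous f /\ bary_convex f.

Lemma bary_sublinear_strict f : bary_sublinear f -> bary_strict f.
Proof.
move=> [fh _]; rewrite /bary_strict -[in LHS](conv0 bot bot).
by have /= -> := fh _ bot; rewrite mul0e.
Qed.

End Maps.

Definition spec_le {T : topologicalType} (x y : T) :=
  forall U : set T, open U -> U x -> U y.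

Definition spec_least {T : topologicalType} (bot : T) := forall x, spec_le bot x.

(* The Scott topology on [0,oo], seen inside \bar R. *)
Definition scott_open {R : realType} (U : set (\bar R)) :=
  [\/ U = set0, U = [set t | 0 <= t]
    | exists2 a : R, (0 <= a)%R & U = [set t | a%:E < t]].

(* For maps into [0,oo], the library's lower semicontinuity is continuity with
   respect to the Scott topology. *)
Lemma lower_semicontinuous_scott {R : realType} {T : topologicalType}
    (f : T -> \bar R) : (forall x, 0 <= f x) ->
  lower_semicontinuous f <-> (forall U, scott_open U -> open (f @^-1` U)).
Proof.
move=> f0; rewrite lower_semicontinuousP; split=> [h U|h a].
- case=> [->|->|[a a0 ->]]; last exact: h.
  + by rewrite preimage_set0; exact: open0.
  + rewrite (_ : _ @^-1` _ = setT); first exact: openT.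
    by apply/seteqP; split=> x //= _; exact: f0.
- have [a0|a0] := leP 0%R a.
    by apply: (h [set t | a%:E < t]); constructor 3; exists a.
  rewrite (_ : [set _ | _] = setT); first exact: openT.
  by apply/seteqP; split=> x //= _; rewrite (lt_le_trans _ (f0 x))// lte_fin.
Qed.

(* Main.v *)
Require Import Defs.
From mathcomp Require Import all_boot all_order all_algebra.
From mathcomp Require Import interval_inference.
From mathcomp Require Import boolp classical_sets reals ereal topology normedtype.
From mathcomp Require Import convex.
From mathcomp Require Import ring lra.

(** Among the convex maps lying between q and p there is a minimal one, m: the
    pointwise infimum of a chain of convex maps is convex, so Zorn's lemma
    applies ([exists_minimal_convex]). This single map m is the required
    Lambda, because any convex map that can be built between q and m must be m
    itself. This is used twice.

    - m is lower semicontinuous. Its lower semicontinuous envelope lies below m,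
      and above q since q is lower semicontinuous. The envelope of a convex map
      is again convex ([bary_convex_lsc_env]): x +_a y is continuous in x and
      in y separately, so the inequality f^(x +_a y) <= a f(x) + (1-a) f(y) can
      be improved to one with f^ on the right in one variable at a time.

    - m is concave, hence affine ([minimal_convex_affine]). Fix b and a value c.
      If m (x +_s b) >= s q(x) + (1-s) c for all s and x, then
        x |-> inf_(0 < s <= 1) (m (x +_s b) - (1-s) c) / s
      is a convex map between q and m, so it is m; this means that
      m (x +_s b) >= s m(x) + (1-s) c. In other words q(x) may be exchanged for
      m(x) ([minimal_convex_exchange]). As q is concave, the hypothesis holds
      for c = q(b); the conclusion, read with x and b swapped, is the hypothesis
      for c = m(b), and a second exchange gives the concavity of m. For infinite
      c the exchange is immediate, since then both inequalities force
      m (x +_s b) to be infinite when s < 1.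

    In the pointed case m(bot) <= p(bot) = 0, and an affine map vanishing at bot
    is homogeneous. *)

Import Order.TTheory GRing.Theory Num.Theory.

Local Open Scope classical_set_scope.
Local Open Scope ring_scope.
Local Open Scope convex_scope.

(** * Barycentric weights *)

Section Weights.
Context {R : realType}.

Lemma exists_i01 (r : R) : 0 <= r <= 1 -> exists a : {i01 R}, a%:num = r.
Proof. by move=> /andP[r0 r1]; exists (Itv01 r0 r1). Qed.

Lemma i01_cases (a : {i01 R}) :
  [\/ a = 0%:i01, a = 1%:i01 | (0 < a%:num < 1)%R].
Proof.
have [a0|a0] := eqVneq a%:num 0%R; first by constructor 1; exact/val_inj.
have [a1|a1] := eqVneq a%:num 1%R; first by constructor 2; exact/val_inj.
by constructor 3; rewrite !lt_neqAle a1 eq_sym a0 ge0/= le1.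
Qed.

Lemma convC_num {B : convType R} (a b : {i01 R}) (x y : B) :
  b%:num = 1 - a%:num -> x <| a |> y = y <| b |> x.
Proof. by move=> ba; rewrite convC; congr (_ <| _ |> _); apply/val_inj. Qed.

(** Both sides are the combination of x, y and b with weights a u, (1 - a) u
    and 1 - u: the two contributions of b on the left merge into one. *)
Lemma conv_conv_common {B : convType R} (l s t a u : {i01 R}) (x y b : B) :
  l%:num < 1 ->
  l%:num * s%:num = a%:num * u%:num ->
  (1 - l%:num) * t%:num = (1 - a%:num) * u%:num ->
  (x <| s |> b) <| l |> (y <| t |> b) = (x <| a |> y) <| u |> b.
Proof.
move=> l1 lsE ltE.
have s01 : 0 <= s%:num <= 1 by rewrite ge0/= le1.
have t01 : 0 <= t%:num <= 1 by rewrite ge0/= le1.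
have l0 : 0 <= l%:num by [].
have ls01 : 0 <= s%:num * l%:num <= 1 by nra.
have ls_gt0 : 0 < 1 - s%:num * l%:num by nra.
(* The left side is x +_v (b +_k (y +_t b)), where k' = 1 - k; regrouping
   b +_k (y +_t b) as y +_w b gives y the weight w = k' t. *)
have [k' k'E] : exists k' : {i01 R}, 1 - l%:num = (1 - s%:num * l%:num) * k'%:num.
  have [|k' k'E] := @exists_i01 ((1 - l%:num) / (1 - s%:num * l%:num)).
    by rewrite divr_ge0 ?ler_pdivrMr ?mul1r//; nra.
  by exists k'; rewrite k'E mulrC divfK// gt_eqF.
have k'01 : 0 <= k'%:num <= 1 by rewrite ge0/= le1.
have [v vE] := @exists_i01 (s%:num * l%:num) ls01.
have [k kE] : exists k : {i01 R}, k%:num = 1 - k'%:num by apply: exists_i01; lra.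
have [w wE] : exists w : {i01 R}, w%:num = k'%:num * t%:num.
  by apply: exists_i01; nra.
have [w' w'E] : exists w' : {i01 R}, w'%:num = 1 - w%:num.
  by apply: exists_i01; rewrite wE; nra.
have [r rE] : exists r : {i01 R}, k%:num = r%:num * w'%:num.
  have [w0|w0] := eqVneq w'%:num 0; first by exists 0%:i01 => /=; nra.
  have w'_gt0 : 0 < w'%:num by rewrite lt_neqAle eq_sym w0 ge0.
  have [|r rE] := @exists_i01 (k%:num / w'%:num); last first.
    by exists r; rewrite rE divfK.
  by rewrite divr_ge0//= ?ler_pdivrMr ?mul1r// w'E wE kE; nra.
have [t' t'E] : exists t' : {i01 R}, t'%:num = 1 - t%:num by apply: exists_i01; lra.
rewrite -(@convA _ _ v k s l)//; last by rewrite /unstable.onem vE kE k'E; ring.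
rewrite (@convC_num _ t t' y b)// (@convA _ _ k t' r w')//; last first.
  by rewrite /unstable.onem w'E wE kE t'E; ring.
rewrite convmm -(@convC_num _ w w' y b)//.
apply: convA; first by rewrite vE mulrC.
rewrite /unstable.onem vE wE; move: lsE ltE; rewrite k'E; nra.
Qed.

End Weights.

(** * Convexity of infima *)

Local Open Scope ereal_scope.

Section Infima.
Context {R : realType}.
Implicit Types (S : set (\bar R)) (v w : \bar R).

Lemma le_ge0_addey v w : 0 <= v -> w <= v + +oo.
Proof. by case: v => //= *; rewrite leey. Qed.

Lemma le_mule_infD {S} (c : R) v w : (0 < c)%R -> lbound S 0 -> 0 <= w ->
  (forall t, S t -> v <= c%:E * t + w) -> v <= c%:E * ereal_inf S + w.
Proof.
move=> c0 S0 w0 vS.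
have infS0 : 0 <= ereal_inf S by exact: le_ereal_inf_tmp.
case: w w0 vS => [w _ vS|_ _|//]; last first.
  by rewrite le_ge0_addey// mule_ge0// lee_fin ltW.
rewrite -leeBlDr// -lee_pdivrMl//; apply: le_ereal_inf_tmp => t St.
by rewrite lee_pdivrMl// leeBlDr// vS.
Qed.

Lemma bary_convexW {B : convType R} (f : B -> \bar R) :
  (forall (a : {i01 R}) x y, (0 < a%:num < 1)%R ->
    f (x <| a |> y) <= a%:num%:E * f x + (1 - a%:num)%R%:E * f y) ->
  bary_convex f.
Proof.
move=> fP a x y; have [->|->|a01] := i01_cases a; last exact: fP.
- by rewrite conv0/= mul0e add0e subr0 mul1e.
- by rewrite conv1/= mul1e subrr mul0e adde0.
Qed.

(** Covers both the infimum of a chain of functions and infima over a weight. *)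
Lemma bary_convex_inf {B : convType R} (S : B -> set (\bar R)) :
  (forall x, lbound (S x) 0) ->
  (forall (a : {i01 R}) x y s t, (0 < a%:num < 1)%R -> S x s -> S y t ->
    exists2 u, S (x <| a |> y) u & u <= a%:num%:E * s + (1 - a%:num)%R%:E * t) ->
  bary_convex (fun x => ereal_inf (S x)).
Proof.
move=> S0 SP; apply: bary_convexW => a x y /[dup] a01 /andP[a0 a1].
have b0 : (0 < 1 - a%:num)%R by rewrite subr_gt0.
apply: le_mule_infD => //.
  by rewrite mule_ge0//; exact: le_ereal_inf_tmp.
move=> s Ss; rewrite addeC; apply: le_mule_infD => //.
  by rewrite mule_ge0// (S0 x).
move=> t St; rewrite addeC; have [u Su us] := SP a x y s t a01 Ss St.
exact: le_trans (ereal_inf_lbound Su) us.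
Qed.

End Infima.

(** * Lower semicontinuous envelopes *)

Section LscEnvelope.
Context {R : realType}.

Definition lsc_env {T : topologicalType} (f : T -> \bar R) (x : T) : \bar R :=
  ereal_sup [set g x | g in [set g : T -> \bar R |
    lower_semicontinuous g /\ forall y, g y <= f y]].

Lemma lsc_env_le {T : topologicalType} (f : T -> \bar R) x : lsc_env f x <= f x.
Proof. by apply: ge_ereal_sup => _ [g [_ gf] <-]. Qed.

Lemma le_lsc_env {T : topologicalType} (f g : T -> \bar R) :
  lower_semicontinuous g -> (forall y, g y <= f y) -> forall x, g x <= lsc_env f x.
Proof. by move=> glsc gf x; apply: ereal_sup_ubound; exists g. Qed.

Lemma lsc_env_lsc {T : topologicalType} (f : T -> \bar R) :
  lower_semicontinuous (lsc_env f).
Proof.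
move=> x a /ereal_sup_gt[_ [g [glsc gf] <-] agx].
have [V Vx Vg] := glsc _ _ agx; exists V => // y /Vg /lt_le_trans; apply.
exact: le_lsc_env.
Qed.

Lemma lsc_env_ge0 {T : topologicalType} (f : T -> \bar R) :
  (forall x, 0 <= f x) -> forall x, 0 <= lsc_env f x.
Proof.
move=> f0; apply: (@le_lsc_env _ f (fun=> 0)) => // x r r0.
by exists setT => //; exact: filterT.
Qed.

(** For finite w, the map z |-> (f^(z +_a y) - w) / a is lower semicontinuous
    and lies below f, hence below the envelope f^ of f. *)
Lemma lsc_env_slice {B : semitopBaryType R} (f : B -> \bar R) (a : {i01 R})
    (w : \bar R) (y : B) :
  (0 < a%:num)%R -> (forall x, 0 <= f x) -> 0 <= w ->
  (forall x, lsc_env f (x <| a |> y) <= a%:num%:E * f x + w) ->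
  forall x, lsc_env f (x <| a |> y) <= a%:num%:E * lsc_env f x + w.
Proof.
move=> a0 f0 w0 fw x.
case: w w0 fw => [w _ fw|_ _|//]; last first.
  by rewrite le_ge0_addey// mule_ge0// lsc_env_ge0.
rewrite -leeBlDr// -lee_pdivrMl//.
pose g z := (a%:num^-1)%R%:E * (lsc_env f (z <| a |> y) - w%:E).
apply: (@le_lsc_env _ f g) => [|z]; last by rewrite lee_pdivrMl// leeBlDr.
apply/lower_semicontinuousP => r.
rewrite (_ : [set _ | _] =
    (fun z => z <| a |> y) @^-1` [set z | (a%:num * r + w)%R%:E < lsc_env f z]).
  apply: open_comp => [z _|]; first exact: conv_continuousl.
  by move/lower_semicontinuousP : (@lsc_env_lsc _ f); exact.
apply/seteqP; split => z /=;
  by rewrite lte_pdivlMl// EFinD EFinM lteBrDr.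
Qed.

Lemma bary_convex_lsc_env {B : semitopBaryType R} (f : B -> \bar R) :
  (forall x, 0 <= f x) -> bary_convex f -> bary_convex (lsc_env f).
Proof.
move=> f0 fc; apply: bary_convexW => a x y /andP[a0 a1].
have b0 : (0 < 1 - a%:num)%R by rewrite subr_gt0.
(* Improve f y to its envelope, x being fixed, after improving f x. *)
rewrite convC addeC; apply: lsc_env_slice => //= [|{}y].
  by rewrite mule_ge0// lsc_env_ge0.
rewrite addeC -convC; apply: lsc_env_slice => //= [|{}x].
  by rewrite mule_ge0// lee_fin ltW.
exact: le_trans (lsc_env_le _ _) (fc _ _ _).
Qed.

End LscEnvelope.

(** * Minimal convex maps above a concave map *)

Section Minimal.
Context {R : realType} {B : convType R}.
Implicit Types m p q : B -> \bar R.

Definition minimal_convex q m :=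
  [/\ bary_convex m, forall x, q x <= m x &
    forall g, bary_convex g -> (forall x, q x <= g x) ->
      (forall x, g x <= m x) -> forall x, m x <= g x].

Lemma exists_minimal_convex q p :
  (forall x, 0 <= q x) -> bary_convex p -> (forall x, q x <= p x) ->
  exists2 m, minimal_convex q m & forall x, m x <= p x.
Proof.
move=> q0 pc qp.
pose P m := [/\ bary_convex m, forall x, q x <= m x & forall x, m x <= p x].
pose below (f g : {m | P m}) := `[< forall x, sval g x <= sval f x >].
have [||A Atot|[m [mc qm mp]] mmin] :=
  @ZL_preorder _ (exist P p (And3 pc qp (fun=> lexx _))) below.
- by move=> f; apply/asboolP.
- move=> f g h /asboolP fg /asboolP gh; apply/asboolP => x.
  exact: le_trans (fg x).
- have [->|/set0P[f0 Af0]] := eqVneq A set0.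
    by exists (exist P p (And3 pc qp (fun=> lexx _))).
  pose S x := [set sval f x | f in A].
  have PS : P (fun x => ereal_inf (S x)).
    split=> [|x|x].
    + apply: bary_convex_inf => [x _ [[f [fc qf fp]] _ <-]|] /=.
        exact: le_trans (qf x).
      move=> a x y _ _ _ [f Af <-] [g Ag <-].
      (* On a chain, the smaller of f and g serves as a common lower bound. *)
      wlog fg : f g Af Ag a x y / below f g => [H|].
        have [/H|gf] := Atot f g Af Ag; first exact.
        have [u] := H g f Ag Af (1 - a%:num)%:i01%R y x gf.
        by rewrite -convC/= subKr addeC; exists u.
      exists (sval g (x <| a |> y)); first by exists g.
      have [gc _ _] := svalP g; apply: le_trans (gc _ _ _) _.
      move/asboolP : fg => fg.
      by apply: leeD => //; exact: lee_wpmul2l.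
    + by apply: le_ereal_inf_tmp => _ [[f [fc qf fp]] _ <-].
    + have [_ _ f0p] := svalP f0; apply: le_trans (f0p x).
      by apply: ereal_inf_lbound; exists f0.
  exists (exist P _ PS) => f Af; apply/asboolP => x /=.
  by apply: ereal_inf_lbound; exists f.
- exists m => //; split=> // g gc qg gm.
  have gp x : g x <= p x by exact: le_trans (mp x).
  have /= := mmin (exist P g (And3 gc qg gp)).
  by rewrite /below/= => /(_ (asboolT gm))/asboolP.
Qed.

(** The infimum of this set is inf_t (m (x +_t b) - (1-t) c) / t, in a form
    that involves only real numbers even where m is infinite. *)
Definition exchange_bounds m b (c : R) x : set (\bar R) :=
  [set r%:E | r in [set r : R | exists2 t : {i01 R}, (0 < t%:num)%R &
    m (x <| t |> b) <= (t%:num * r + (1 - t%:num) * c)%R%:E]].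

Lemma bary_convex_exchange_bounds m b (c : R) : bary_convex m ->
  (forall x, lbound (exchange_bounds m b c x) 0) ->
  bary_convex (fun x => ereal_inf (exchange_bounds m b c x)).
Proof.
move=> mc E0; apply: bary_convex_inf => // a y z v v' /andP[a0 a1].
move=> [r [t t0 tr] <-] [r' [t' t'0 tr'] <-].
exists (a%:num * r + (1 - a%:num) * r')%R%:E; last by [].
eexists; last reflexivity.
(* With 1/u = a/t + (1-a)/t', that is u = t t' / d, the point (y +_a z) +_u b
   is the combination of y +_t b and z +_t' b with weight l = a u / t. *)
set d := (a%:num * t'%:num + (1 - a%:num) * t%:num)%R.
have t1 : (t%:num <= 1)%R by [].
have t'1 : (t'%:num <= 1)%R by [].
have d0 : (0 < d)%R by rewrite /d; nra.
have tt' : (t%:num * t'%:num <= t'%:num)%R by nra.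
have tt : (t%:num * t'%:num <= t%:num)%R by nra.
have [u uE] : exists u : {i01 R}, u%:num = (t%:num * t'%:num / d)%R.
  apply: exists_i01; apply/andP; split.
    by rewrite divr_ge0 ?mulr_ge0 ?ltW.
  by rewrite ler_pdivrMr// mul1r /d; nra.
have [l lE] : exists l : {i01 R}, l%:num = (a%:num * t'%:num / d)%R.
  apply: exists_i01; apply/andP; split.
    by rewrite divr_ge0 ?mulr_ge0 ?ltW.
  by rewrite ler_pdivrMr// mul1r /d; nra.
exists u; first by rewrite uE divr_gt0// mulr_gt0.
rewrite -(@conv_conv_common _ _ l t t')//; first last.
- by rewrite uE lE /d; field; rewrite -/d gt_eqF.
- by rewrite uE lE; field; rewrite gt_eqF.
- by rewrite lE ltr_pdivrMr// /d; nra.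
apply: le_trans (mc _ _ _) _.
apply: (@le_trans _ _ (l%:num%:E * (t%:num * r + (1 - t%:num) * c)%R%:E +
  (1 - l%:num)%R%:E * (t'%:num * r' + (1 - t'%:num) * c)%R%:E)).
  by apply: leeD; exact: lee_wpmul2l.
rewrite -!EFinM -EFinD lee_fin le_eqVlt; apply/orP; left; apply/eqP.
by rewrite uE lE /d; field; rewrite -/d gt_eqF.
Qed.

(** The infimum of [exchange_bounds] is a convex map; the hypothesis puts it
    above q and the weight 1 puts it below m, so that minimality makes it m. *)
Lemma minimal_convex_exchange q m b (c : \bar R) :
  (forall x, 0 <= q x) -> minimal_convex q m -> 0 <= c ->
  (forall (s : {i01 R}) x,
    s%:num%:E * q x + (1 - s%:num)%R%:E * c <= m (x <| s |> b)) ->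
  forall (s : {i01 R}) x,
    s%:num%:E * m x + (1 - s%:num)%R%:E * c <= m (x <| s |> b).
Proof.
move=> q0 [mc qm mmin] c0 qc s x.
have m0 z : 0 <= m z by exact: le_trans (qm z).
have [->|->|/andP[s0 s1]] := i01_cases s.
- by have := qc 0%:i01%R x; rewrite /= !mul0e.
- by rewrite conv1/= mul1e subrr mul0e adde0.
case: c c0 qc => [c _ qc|_ qc|//]; last first.
  apply: le_trans (qc s x); rewrite gt0_muley ?lte_fin ?subr_gt0//.
  by rewrite le_ge0_addey// mule_ge0.
pose E := exchange_bounds m b c.
have qE z : lbound (E z) (q z).
  move=> _ [r [t t0 tr] <-]; have := le_trans (qc t z) tr.
  by rewrite -EFinM EFinD leeD2rE// EFinM lee_pmul2l.
have gc : bary_convex (fun z => ereal_inf (E z)).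
  apply: bary_convex_exchange_bounds => // z v /qE.
  exact: le_trans.
have gm z : ereal_inf (E z) <= m z.
  have := m0 z; case mz : (m z) => [r| |]// _; last by rewrite leey.
  apply: ereal_inf_lbound; exists r => //; exists 1%:i01%R => //=.
  by rewrite conv1 mz mul1r subrr mul0r addr0.
have mE := mmin _ gc (fun z => le_ereal_inf_tmp (qE z)) gm.
have := m0 (x <| s |> b).
case mv : (m (x <| s |> b)) => [v| |]// _; last by rewrite leey.
rewrite -EFinM -leeBrDr// -lee_pdivlMl//; apply: le_trans (mE x) _.
apply: ereal_inf_lbound.
exists (s%:num^-1 * (v - (1 - s%:num) * c))%R => //; exists s => //.
by rewrite mv mulrA divff ?gt_eqF// mul1r subrK.
Qed.

(** The exchange lemma turns the concavity of q into that of m in two steps,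
    one for each of the two points. *)
Lemma minimal_convex_affine q m :
  (forall x, 0 <= q x) -> bary_concave q -> minimal_convex q m -> bary_affine m.
Proof.
move=> q0 qc mm; have [mc qm _] := mm.
have m_ge0 x : 0 <= m x by exact: le_trans (qm x).
have mq b : forall (s : {i01 R}) x,
    s%:num%:E * m x + (1 - s%:num)%R%:E * q b <= m (x <| s |> b).
  apply: minimal_convex_exchange mm _ _ => // s x.
  exact: le_trans (qc _ _ _) (qm _).
move=> a x y; apply/eqP; rewrite eq_le mc/=.
apply: minimal_convex_exchange mm _ _ _ _ => // s z.
rewrite convC addeC; have /= := mq z (1 - s%:num)%:i01%R y.
by rewrite subKr.
Qed.

End Minimal.

Theorem theorem8p2 (R : realType) (B : semitopBaryType R) (p q : B -> \bar R)
    (p_ge0 : forall x : B, 0 <= p x) (q_ge0 : forall x : B, 0 <= q x)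
    (p_convex : bary_convex p)
    (q_concave : bary_concave q) (q_lsc : lower_semicontinuous q)
    (le_qp : forall x : B, q x <= p x) :
  exists L : B -> \bar R,
    [/\ forall x : B, 0 <= L x,
        bary_affine L,
        lower_semicontinuous L,
        forall x : B, q x <= L x <= p x
      & forall bot : B, spec_least bot -> bary_strict bot p ->
          bary_linear bot L].
Proof.
have [m mm mp] := exists_minimal_convex _ _ q_ge0 p_convex le_qp.
have [mc qm mmin] := mm.
have m0 x : 0 <= m x by exact: le_trans (qm x).
have maff : bary_affine m by exact: minimal_convex_affine mm.
have menv x : m x = lsc_env m x.
  apply/eqP; rewrite eq_le lsc_env_le andbT; apply: mmin.
  - exact: bary_convex_lsc_env.
  - exact: le_lsc_env.
  - exact: lsc_env_le.
exists m; split=> //.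
- by rewrite (funext menv); exact: lsc_env_lsc.
- by move=> x; rewrite qm mp.
- move=> bot _ pbot; split=> // a x; rewrite /scal_bot maff.
  have -> : m bot = 0 by apply/eqP; rewrite eq_le m0 andbT -pbot mp.
  by rewrite mule0 adde0.
Qed.
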